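(* For every unital Abelian $\ell$-group $G$, the following are equivalent. (1) $G$ is metrically complete. (2) For some compact a-space $X$, $G$ is isomorphic to $\mathrm{C_a}(X)$ as a unital $\ell$-group. (3) The map $\varepsilon_G\colon G\to\mathrm{C_a}(\operatorname{Max}G)$ that sends $g\in G$ to the evaluation $\operatorname{ev}_g\colon\operatorname{Max}G\to\mathbb{R}$, $\operatorname{ev}_g(x)=x(g)$, is an isomorphism of unital $\ell$-groups.
   Context: **a-spaces.** $\mathbb{N}=\{0,1,2,\dots\}$ is ordered by divisibility ($0$ is the top element, $1$ the bottom); $\operatorname{lcm}$ of a possibly infinite subset of $\mathbb{N}$ is its supremum in this order (so it is $0$ if there is no positive common multiple). $\mathbb{N}$ carries the upper topology of the divisibility order: the sets $\{m\in\mathbb{N}\mid m \text{ divides } n\}$, $n\in\mathbb{N}$, form a subbasis for the closed sets. An a-space $(X,\zeta)$ is a topological space $X$ with a continuous function $\zeta\colon X\to\mathbb{N}$. An a-map $f\colon (X,\zeta)\to(X',\zeta')$ is a continuous map such that $\zeta'(f(x))$ divides $\zeta(x)$ for all $x\in X$. A compact a-space is an a-space whose underlying space is compact. For $p/q\in\mathbb{Q}$ with $p\in\mathbb{Z}$, $q\geq 1$ coprime, $\operatorname{den}(p/q)=q$; for irrational $r$, $\operatorname{den}(r)=0$; $\mathbb{R}$ with the Euclidean topology and $\operatorname{den}$ is an a-space. **$\ell$-groups.** A unital Abelian $\ell$-group is an Abelian lattice-ordered group $G$ with a distinguished element $1$ such that for each $g\in G$ there is a positive integer $p$ with $g\le p\cdot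 1$; a unital $\ell$-homomorphism is a group and lattice homomorphism preserving $1$. $G$ is Archimedean if for all $x,y\in G$, $px\le y$ for all positive integers $p$ implies $x\le 0$. With $|g|=g\vee(-g)$, set $\lVert g\rVert=\inf\{p/q\in\mathbb{Q}\mid p\geq 0,\ q>0,\ q|g|\le p\cdot 1\}$; the pseudometric induced by the unit is $(v,w)\mapsto\lVert v-w\rVert$, which is a metric exactly when $G$ is Archimedean. $G$ is metrically complete if it is Archimedean and Cauchy complete in this metric. **Constructions.** For a compact a-space $X$, $\mathrm{C_a}(X)$ is the unital Abelian $\ell$-group of a-maps $X\to(\mathbb{R},\operatorname{den})$ with pointwise operations and unit the constant function $1$. For a unital Abelian $\ell$-group $G$, $\operatorname{Max}G$ is the set of unital $\ell$-homomorphisms $G\to\mathbb{R}$, with the topology generated by the sets $\{x\in\operatorname{Max}G\mid x(g)\in U\}$ ($g\in G$, $U\subseteq\mathbb{R}$ open) and denominator function $\zeta(x)=\operatorname{lcm}\{\operatorname{den}(x(g))\mid g\in G\}$; it is a compact a-space. *)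

(* Defs.v *)
From HB Require Import structures.
From mathcomp Require Import all_boot all_order all_algebra.
From mathcomp Require Import all_classical all_reals all_analysis.
Import Order.TTheory GRing.Theory Num.Theory.
Import numFieldNormedType.Exports.

Set Implicit Arguments.
Unset Strict Implicit.
Unset Printing Implicit Defensive.

Local Open Scope classical_set_scope.
Local Open Scope ring_scope.

(* The lattice operations are fields of this mixin, and not inherited from
   [Order.Lattice], because Hierarchy Builder rejects a new join of
   [Order.Lattice] with [GRing.Zmodule]: [Num.RealDomain] already contains
   both. *)
HB.mixin Record isUnitalLGroup G of Num.POrderedZmodule G := {
  lmeet : G -> G -> G;
  ljoin : G -> G -> G;
  lunit : G;
  lmeetP : forall x y z : G, (x <= lmeet y z) = (x <= y) && (x <= z);
  ljoinP : forall x y z : G, (ljoin x y <= z) = (x <= z) && (y <= z);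
  lg_leD2l : forall x y z : G, x <= y -> z + x <= z + y;
  lunit_strong : forall g : G, exists2 p : nat, (0 < p)%N & g <= lunit *+ p
}.

#[short(type="unitalLGroupType")]
HB.structure Definition UnitalLGroup :=
  { G of Num.POrderedZmodule G & isUnitalLGroup G }.

Section UnitalLGroupHom.
Variables G H : unitalLGroupType.

Definition unital_lhom (f : G -> H) : Prop :=
  [/\ zmod_morphism f,
      {morph f : x y / lmeet x y},
      {morph f : x y / ljoin x y}
    & f lunit = lunit].

Definition unital_liso (f : G -> H) : Prop := unital_lhom f /\ bijective f.

End UnitalLGroupHom.

Definition labs (G : unitalLGroupType) (g : G) : G := ljoin g (- g).

Definition archimedean_lgroup (G : unitalLGroupType) : Prop :=
  forall x y : G, (forall p : nat, (0 < p)%N -> x *+ p <= y) -> x <= 0.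

Section UnitNorm.
Variables (R : realType) (G : unitalLGroupType).
Implicit Types (g h : G) (r s : R).

Definition unorm_set g : set R :=
  [set r | exists p q : nat,
    [/\ (0 < q)%N, r = p%:R / q%:R & labs g *+ q <= lunit *+ p]].

Definition unorm g : R := inf (unorm_set g).

Lemma lg_leD (x y z t : G) : x <= y -> z <= t -> x + z <= y + t.
Proof.
move=> xy zt; apply: (@le_trans _ _ (x + t)); first exact: lg_leD2l.
by rewrite addrC [y + t]addrC; exact: lg_leD2l.
Qed.

Lemma lg_leMn (x y : G) n : x <= y -> x *+ n <= y *+ n.
Proof.
by move=> xy; elim: n => [|n IH]; rewrite ?mulr0n// !mulrS; exact: lg_leD.
Qed.

Lemma labsN g : labs (- g) = labs g.
Proof.
by apply/le_anti; rewrite /labs !ljoinP opprK; apply/andP; split;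
  apply/andP; split; have := lexx (ljoin g (- g));
  have := lexx (ljoin (- g) g); rewrite !ljoinP => /andP[? ?] /andP[? ?].
Qed.

Lemma le_labs g : g <= labs g.
Proof. by have := lexx (labs g); rewrite {1}/labs ljoinP => /andP[]. Qed.

Lemma labsD g h : labs (g + h) <= labs g + labs h.
Proof.
rewrite ljoinP lg_leD ?le_labs//= opprD -(labsN g) -(labsN h).
by rewrite lg_leD ?le_labs.
Qed.

Lemma unorm_set_ge0 g : lbound (unorm_set g) 0.
Proof. by move=> r [p [q [_ -> _]]]; rewrite divr_ge0. Qed.

Lemma unorm_set_neq0 g : unorm_set g !=set0.
Proof.
have [p _ gp] := lunit_strong (labs g).
by exists p%:R, p, 1%N; split=> //; rewrite divr1.
Qed.

Lemma unorm0 : unorm 0 = 0.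
Proof.
apply/le_anti/andP; split; last first.
  by apply: lb_le_inf; [exact: unorm_set_neq0|exact: unorm_set_ge0].
apply: ge_inf; first by exists 0; exact: unorm_set_ge0.
exists 0%N, 1%N; split=> //; first by rewrite mul0r.
by rewrite /labs oppr0 mulr0n mulr1n ljoinP lexx.
Qed.

Lemma unormN g : unorm (- g) = unorm g.
Proof. by rewrite /unorm /unorm_set labsN. Qed.

Lemma unormD g h : unorm (g + h) <= unorm g + unorm h.
Proof.
rewrite -lerBlDr; apply: lb_le_inf; first exact: unorm_set_neq0.
move=> r [p [q [q0 -> gpq]]]; rewrite lerBlDr -lerBlDl.
apply: lb_le_inf; first exact: unorm_set_neq0.
move=> s [p' [q' [q'0 -> hpq]]]; rewrite lerBlDl.
apply: ge_inf; first by exists 0; exact: unorm_set_ge0.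
exists (p * q' + p' * q)%N, (q * q')%N; split; first by rewrite muln_gt0 q0.
  rewrite addf_div ?pnatr_eq0 -?lt0n//.
  by rewrite natrD !natrM.
apply: (le_trans (lg_leMn (q * q') (labsD g h))).
rewrite mulrnDl mulrnDr; apply: lg_leD.
  by rewrite !mulrnA; exact: lg_leMn.
by rewrite [(q * _)%N]mulnC !mulrnA; exact: lg_leMn.
Qed.

End UnitNorm.

Definition unit_metric (R : realType) (G : unitalLGroupType) : Type := G.

Section UnitMetric.
Variables (R : realType) (G : unitalLGroupType).
Local Notation M := (unit_metric R G).

Definition udist (v w : G) : R := unorm R (v - w).

Definition uball (v : M) (e : R) : set M := [set w : M | udist v w < e].

Lemma uball_center (v : M) (e : R) : 0 < e -> uball v e v.
Proof. by move=> e0; rewrite /uball /udist/= subrr unorm0. Qed.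

Lemma uball_sym (v w : M) (e : R) : uball v e w -> uball w e v.
Proof. by rewrite /uball /udist/= -unormN opprB. Qed.

Lemma uball_triangle (v w z : M) (e1 e2 : R) :
  uball v e1 w -> uball w e2 z -> uball v (e1 + e2) z.
Proof.
rewrite /uball /udist/= => vw wz; apply: le_lt_trans (ltrD vw wz).
have -> : (v : G) - z = (v - w) + (w - z) by rewrite addrA subrK.
exact: unormD.
Qed.

HB.instance Definition _ := Choice.copy M G.
HB.instance Definition _ := hasNbhs.Build M (nbhs_ (entourage_ uball)).
HB.instance Definition _ := Nbhs_isPseudoMetric.Build R M
  erefl uball_center uball_sym uball_triangle erefl.

End UnitMetric.

Definition metrically_complete (R : realType) (G : unitalLGroupType) : Prop :=
  archimedean_lgroup G /\
  forall u : nat -> unit_metric R G,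
    cauchy (u @ \oo) -> exists l : unit_metric R G, u @ \oo --> l.

(* Unlike [nat], whose topology in the library is discrete, the alias [natdvd]
   of [nat] (ordered by divisibility) gets the upper topology: the given open
   subbasis consists of the complements of the closed sets
   [[set m | m %| n]]. *)
Definition natdvd_subbase : set (set natdvd) :=
  [set ~` [set m : natdvd | (m %| n)%N] | n in [set: nat]].

HB.instance Definition _ :=
  isSubBaseTopological.Build natdvd natdvd_subbase id.

(* Supremum for divisibility. The supremum always exists ([0] is the top
   element), so the default value [1] is only used when [A] is empty, where it
   is the supremum; see [lcm_setP]. *)
Definition lcm_set (A : set natdvd) : natdvd := supremum (1%N : natdvd) A.

HB.mixin Record isASpace X of Topological X := {
  zeta : X -> natdvd;
  zeta_continuous : continuous zeta
}.

#[short(type="aspaceType")]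
HB.structure Definition ASpace := { X of Topological X & isASpace X }.

HB.mixin Record isCompactSpace X of Topological X := {
  compact_space : compact [set: X]
}.

#[short(type="compactASpaceType")]
HB.structure Definition CompactASpace := { X of ASpace X & isCompactSpace X }.

Definition amap (X Y : aspaceType) (f : X -> Y) : Prop :=
  continuous f /\ forall x : X, (zeta (f x) %| zeta x)%N.

(* [denq] is the positive denominator of a fraction in lowest terms; as [ratr]
   is injective, [xget] returns the only rational that maps to [r]. *)
Definition den (R : realType) (r : R) : natdvd :=
  if r \in @rational R
  then `|denq (xget 0%R [set q : rat | ratr q = r])|%N
  else 0%N.

Section SubbaseTopology.
Variables (T : topologicalType) (D : set (set T)).
Hypothesis openD :
  open = [set \bigcup_(B in E) B | E in subset^~ (finI_from D id)].

Lemma subbase_cvg (F : set_system T) (t : T) : Filter F ->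
  (forall B, D B -> B t -> F B) -> F --> t.
Proof.
move=> FF FD A /=; rewrite nbhsE => -[B [oB Bt] BA].
move: oB; rewrite openD => -[E EI EB]; move: Bt; rewrite -EB => -[C EC Ct].
have [D' D'D CE] := EI _ EC.
apply: (@filterS _ F _ C).
  by apply: subset_trans BA; rewrite -EB; exact: bigcup_sup.
rewrite -CE; apply: filter_bigI => i D'i; apply: FD.
  by have := D'D _ D'i; rewrite inE.
by move: Ct; rewrite -CE; apply.
Qed.

Lemma subbase_open B : D B -> open B.
Proof.
move=> DB; rewrite openD; exists [set B]; last by rewrite bigcup_set1.
by move=> _ ->; exact: finI_from1.
Qed.

End SubbaseTopology.

Lemma natdvd_openE : open =
  [set \bigcup_(B in E) B | E in subset^~ (finI_from natdvd_subbase id)].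
Proof. by []. Qed.

Lemma natdvd_continuous (X : topologicalType) (f : X -> natdvd) :
  (forall n : nat, closed [set x | (f x %| n)%N]) -> continuous f.
Proof.
move=> fcl x; apply: (subbase_cvg natdvd_openE) => _ [n _ <-] fxn.
by apply: open_nbhs_nbhs; split => //; apply/closed_openC/fcl.
Qed.

Lemma natdvd_closed (n : nat) : closed [set m : natdvd | (m %| n)%N].
Proof.
by rewrite -openC; apply: (subbase_open natdvd_openE); exists n.
Qed.

Lemma lcm_setP (A : set natdvd) (n : nat) :
  (lcm_set A %| n)%N <-> forall m, A m -> (m %| n)%N.
Proof.
suff [k [Ak kA]] : exists k : natdvd, supremums A k.
  have -> : lcm_set A = k.
    rewrite /lcm_set /supremum; case: ifPn => [/eqP A0|_].
      by apply/eqP; rewrite eq_sym -dvdn1; apply: kA => m; rewrite A0.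
    case: xgetP => [y _ yA|/(_ k)]; last by case.
    by apply: (is_subset1_supremums yA).
  split=> [kn m Am|nA]; last exact: kA.
  by apply: dvdn_trans kn; exact: Ak.
have [[m m0 Am]|Apos] := pselect (exists2 m, (0 < m)%N & ubound A m); last first.
  exists 0%N; split => [m _|m Am]; first exact: dvdn0.
  by case: m Am => // m Am; exfalso; apply: Apos; exists m.+1.
pose P k := (0 < k)%N && `[< ubound A (k : natdvd) >].
have exP : exists k, P k by exists m; rewrite /P m0; apply/asboolP.
case: (ex_minnP exP) => k /andP[k0 /asboolP Ak] kmin.
exists k; split=> // j An.
have gk : (gcdn k j <= k)%N by rewrite dvdn_leq ?dvdn_gcdl.
have : (k <= gcdn k j)%N.
  apply: kmin; rewrite /P gcdn_gt0 k0; apply/asboolP => a Aa.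
  by rewrite [(_ <= _)%O]dvdn_gcd; apply/andP; split; [exact: Ak|exact: An].
move=> kg; have /eqP gE : gcdn k j == k by rewrite eqn_leq gk.
by rewrite [(_ <= _)%O](_ : _ = (k %| j)%N)// -gE dvdn_gcdr.
Qed.

Section RealInstances.
Variable R : realType.

Lemma real_leD2l (x y z : R) : x <= y -> z + x <= z + y.
Proof. by rewrite lerD2l. Qed.

Lemma real_strong (r : R) : exists2 p : nat, (0 < p)%N & r <= 1 *+ p.
Proof.
exists (Num.bound `|r|).+1 => //; apply: (le_trans (ler_norm r)); apply: ltW.
by apply: (lt_trans (archi_boundP (normr_ge0 r))); rewrite ltr_nat.
Qed.

Lemma den_dvd (r : R) (n : nat) :
  (den r %| n)%N = (n%:R * r \is a Num.int).
Proof.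
rewrite /den; case: ifPn => [|rirr]; last first.
  rewrite dvd0n; apply/eqP/idP => [->|nr]; first by rewrite mul0r rpred0.
  apply/eqP/negPn/negP => n0; move/negP: rirr; apply; rewrite inE.
  move/intrP: nr => [m nr]; exists (m%:~R / n%:R) => //.
  rewrite fmorph_div/= ratr_int ratr_nat -nr mulrAC divff ?mul1r//.
  by rewrite pnatr_eq0.
rewrite inE => -[q0 _ q0r]; case: xgetP => [q _ /= qr|/(_ q0)//].
have nq : n%:R * r = ratr (n%:R * q) by rewrite rmorphM/= qr ratr_nat.
have dn : (`|denq q|%N%:R : rat) = (denq q)%:~R.
  by rewrite -[in RHS](absz_denq q).
apply/idP/idP => [/dvdnP[k nk]|/intrP[m]].
  rewrite nq nk natrM dn -mulrA [_ * q]mulrC -numqE rmorphM/= ratr_nat ratr_int.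
  by rewrite rpredM ?natr_int// intr_int.
rewrite nq -ratr_int => /fmorph_inj nqm.
have e : (n%:Z * numq q = m * denq q)%R.
  apply: (@intr_inj rat); rewrite !rmorphM/= -nqm numqE.
  by rewrite mulrA.
have : (`|denq q| %| n * `|numq q|)%N.
  by apply/dvdnP; exists `|m|%N; rewrite -abszM -e abszM.
by rewrite Gauss_dvdl// coprime_sym coprime_num_den.
Qed.

Lemma int_closed : closed [set r : R | r \is a Num.int].
Proof.
rewrite -openC openE => r /= /negP ri.
have /andP[fl fu] := floor_itv r.
have fl' : (Num.floor r)%:~R < r.
  by rewrite lt_neqAle fl andbT; apply: contra ri; rewrite intrEfloor.
have : nbhs r ([set x : R | (Num.floor r)%:~R < x] `&`
               [set x | x < (Num.floor r + 1)%:~R]).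
  apply: filterI; apply: open_nbhs_nbhs; first by split; [exact: open_gt|].
  by split; [exact: open_lt|].
apply: filterS => x /= [x1 x2] /intrP[m xm]; move: x1 x2; rewrite xm !ltr_int.
by rewrite ltzD1 => /lt_le_trans h /h; rewrite ltxx.
Qed.

Lemma mulnr_continuous (n : nat) : continuous (fun r : R => n%:R * r).
Proof. by move=> r; apply: cvgMr; exact: cvg_id. Qed.

Lemma den_continuous : continuous (@den R).
Proof.
apply: natdvd_continuous => n.
rewrite (_ : mkset _ = (fun r : R => n%:R * r) @^-1` [set r | r \is a Num.int]).
  by apply: preimage_closed int_closed => x _; exact: mulnr_continuous.
by apply/seteqP; split=> r /=; rewrite den_dvd.
Qed.

End RealInstances.

#[non_forgetful_inheritance]
HB.instance Definition _ (R : realType) := isUnitalLGroup.Build R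
  (fun x y z : R => le_min x y z) (fun x y z : R => ge_max z x y)
  (@real_leD2l R) (@real_strong R).

#[non_forgetful_inheritance]
HB.instance Definition _ (R : realType) :=
  isASpace.Build R (@den_continuous R).

Definition amap_pred (R : realType) (X : compactASpaceType) : {pred X -> R} :=
  fun f => `[< amap f >].
Arguments amap_pred R X _ : clear implicits.

Record Ca (R : realType) (X : compactASpaceType) := MkCa {
  Ca_fun :> X -> R;
  Ca_amap : Ca_fun \in amap_pred R X
}.

Section Ca.
Variables (R : realType) (X : compactASpaceType).
Local Notation C := (Ca R X).

Lemma amapE (f : X -> R) : f \in amap_pred R X <-> amap f.
Proof. by split=> /asboolP. Qed.

Lemma zeta_real (r : R) : zeta r = den r. Proof. by []. Qed.

Lemma amapB (f g : X -> R) : amap f -> amap g -> amap (f - g).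
Proof.
move=> [fc fz] [gc gz]; split=> x; first by apply: cvgB; [exact: fc|exact: gc].
move: (fz x) (gz x); rewrite !zeta_real !den_dvd => fx gx.
by rewrite [(f - g) x](_ : _ = f x - g x)// mulrBr rpredB.
Qed.

Lemma amap_min (f g : X -> R) : amap f -> amap g -> amap (f \min g).
Proof.
move=> [fc fz] [gc gz]; split=> x.
  by apply: (@continuous_min R X f g); [exact: fc|exact: gc].
by rewrite /= /Order.min; case: ifP.
Qed.

Lemma amap_max (f g : X -> R) : amap f -> amap g -> amap (f \max g).
Proof.
move=> [fc fz] [gc gz]; split=> x.
  by apply: (@continuous_max R X f g); [exact: fc|exact: gc].
by rewrite /= /Order.max; case: ifP.
Qed.

Lemma amap_cst (m : int) : amap (cst m%:~R : X -> R).
Proof.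
split=> x; first exact: cvg_cst.
by rewrite zeta_real den_dvd rpredM ?natr_int ?intr_int.
Qed.

Lemma amap_pred_zmod : zmod_closed (amap_pred R X).
Proof.
split; first by apply/amapE; exact: (amap_cst 0).
by move=> f g /amapE fa /amapE ga; apply/amapE; exact: amapB.
Qed.

HB.instance Definition _ :=
  GRing.isZmodClosed.Build (X -> R) (amap_pred R X) amap_pred_zmod.

HB.instance Definition _ := [isSub for @Ca_fun R X].
HB.instance Definition _ := [Choice of C by <:].
HB.instance Definition _ := [SubChoice_isSubZmodule of C by <:].
HB.instance Definition _ := Order.SubChoice_isSubPOrder.Build
  FunOrder.fun_display (X -> R) (amap_pred R X) ring_display C.

Definition Ca_meet (f g : C) : C :=
  MkCa ((amapE _).2 (amap_min
    ((amapE _).1 (Ca_amap f)) ((amapE _).1 (Ca_amap g)))).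

Definition Ca_join (f g : C) : C :=
  MkCa ((amapE _).2 (amap_max
    ((amapE _).1 (Ca_amap f)) ((amapE _).1 (Ca_amap g)))).

Definition Ca_unit : C := MkCa ((amapE _).2 (amap_cst 1)).

Lemma Ca_leP (f g : C) : reflect (forall x, f x <= g x) (f <= g).
Proof. by rewrite -Order.le_val; exact: lefP. Qed.

Lemma Ca_addE (f g : C) x : (f + g) x = f x + g x.
Proof. by rewrite [LHS](_ : _ = (val f + val g) x)// -raddfD. Qed.

Lemma Ca_MnE (f : C) n x : (f *+ n) x = f x *+ n.
Proof.
elim: n => [|n IH]; first by rewrite !mulr0n.
by rewrite !mulrS Ca_addE IH.
Qed.

Lemma Ca_meetP (f g h : C) : (f <= Ca_meet g h) = (f <= g) && (f <= h).
Proof.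
apply/Ca_leP/andP => [fgh|[/Ca_leP fg /Ca_leP fh] x].
  by split; apply/Ca_leP => x; move: (fgh x); rewrite /= le_min => /andP[].
by rewrite /= le_min fg fh.
Qed.

Lemma Ca_joinP (f g h : C) : (Ca_join f g <= h) = (f <= h) && (g <= h).
Proof.
apply/Ca_leP/andP => [fgh|[/Ca_leP fg /Ca_leP fh] x].
  by split; apply/Ca_leP => x; move: (fgh x); rewrite /= ge_max => /andP[].
by rewrite /= ge_max fg fh.
Qed.

Lemma Ca_leD2l (f g h : C) : f <= g -> h + f <= h + g.
Proof.
by move=> /Ca_leP fg; apply/Ca_leP => x; rewrite !Ca_addE lerD2l.
Qed.

Lemma Ca_strong (f : C) : exists2 p : nat, (0 < p)%N & f <= Ca_unit *+ p.
Proof.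
have [fc _] := (amapE _).1 (Ca_amap f).
have : bounded_set (range f).
  apply: compact_bounded; apply: continuous_compact compact_space.
  exact: continuous_subspaceT.
move=> [M [_ /(_ (M + 1))]]; rewrite ltrDl ltr01 => /(_ isT) fM.
have [p p0 Mp] := real_strong (M + 1).
exists p => //; apply/Ca_leP => x; rewrite Ca_MnE; apply: le_trans Mp.
by apply: le_trans (ler_norm _) _; apply: fM; exists x.
Qed.

HB.instance Definition _ := isUnitalLGroup.Build C
  Ca_meetP Ca_joinP Ca_leD2l Ca_strong.

End Ca.

Definition lhom_pred (R : realType) (G : unitalLGroupType) : {pred G -> R} :=
  fun x => `[< unital_lhom x >].
Arguments lhom_pred R G _ : clear implicits.

Record Max (R : realType) (G : unitalLGroupType) := MkMax {
  Max_fun :> G -> R;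
  Max_lhom : Max_fun \in lhom_pred R G
}.

HB.instance Definition _ (R : realType) (G : unitalLGroupType) :=
  [isSub for @Max_fun R G].
HB.instance Definition _ (R : realType) (G : unitalLGroupType) :=
  [Choice of Max R G by <:].

Definition Max_subbase (R : realType) (G : unitalLGroupType) :
    set (set (Max R G)) :=
  [set B | exists (g : G) (U : set R),
    open U /\ B = [set x : Max R G | U (x g)]].
Arguments Max_subbase R G : clear implicits.

HB.instance Definition _ (R : realType) (G : unitalLGroupType) :=
  isSubBaseTopological.Build (Max R G) (Max_subbase R G) id.

Section Max.
Variables (R : realType) (G : unitalLGroupType).
Local Notation M := (Max R G).

Lemma lhomE (x : G -> R) : x \in lhom_pred R G <-> unital_lhom x.
Proof. by split=> /asboolP. Qed.

Lemma Max_openE : open =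
  [set \bigcup_(B in E) B | E in subset^~ (finI_from (Max_subbase R G) id)].
Proof. by []. Qed.

Lemma ev_continuous (g : G) : continuous (fun x : M => x g).
Proof.
apply/continuousP => U oU; apply: (subbase_open Max_openE).
by exists g, U.
Qed.

Definition Max_zeta (x : M) : natdvd := lcm_set [set den (x g) | g in setT].

Lemma Max_zeta_dvd (x : M) (n : nat) :
  (Max_zeta x %| n)%N <-> forall g, (den (x g) %| n)%N.
Proof.
rewrite lcm_setP; split=> [xn g|xn _ [g _ <-]]; last exact: xn.
by apply: xn; exists g.
Qed.

Lemma Max_zeta_continuous : continuous Max_zeta.
Proof.
apply: natdvd_continuous => n.
rewrite (_ : mkset _ =
    \bigcap_(g in setT) ((fun x : M => x g) @^-1` [set r | (den r %| n)%N])).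
  apply: closed_bigI => g _; apply: preimage_closed => [x _|].
    exact: ev_continuous.
  rewrite (_ : mkset _ = @den R @^-1` [set m : natdvd | (m %| n)%N])//.
  apply: (@preimage_closed R natdvd); last exact: natdvd_closed.
  by move=> r _; exact: den_continuous.
apply/seteqP; split=> x /=; first by move=> /Max_zeta_dvd xn g _; exact: xn.
by move=> xn; apply/Max_zeta_dvd => g; exact: xn.
Qed.

Lemma lhom_mono (x : G -> R) : unital_lhom x -> {homo x : g h / g <= h}.
Proof.
move=> [_ xI _ _] g h gh.
have /(congr1 x) : lmeet g h = g.
  apply/le_anti/andP; split; last by rewrite lmeetP lexx gh.
  by have := lexx (lmeet g h); rewrite lmeetP => /andP[].
by rewrite xI => /esym ->; rewrite /lmeet/= ge_min lexx orbT.
Qed.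

Lemma lhomD (x : G -> R) : unital_lhom x -> {morph x : g h / g + h}.
Proof.
move=> [xB _ _ _] g h; have x0 : x 0 = 0 by rewrite -(subrr 0) xB subrr.
have xN k : x (- k) = - x k by rewrite -sub0r xB x0 sub0r.
by rewrite -{1}[h]opprK xB xN opprK.
Qed.

Lemma lhomN (x : G -> R) : unital_lhom x -> {morph x : g / - g}.
Proof.
move=> [xB _ _ _] g; have x0 : x 0 = 0 by rewrite -(subrr 0) xB subrr.
by rewrite -sub0r xB x0 sub0r.
Qed.

Lemma lhomMn (x : G -> R) n : unital_lhom x -> {morph x : g / g *+ n}.
Proof.
move=> xh g; elim: n => [|n IH]; last by rewrite !mulrS lhomD// IH.
by case: xh => xB _ _ _; rewrite !mulr0n -(subrr 0) xB subrr.
Qed.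

Lemma lhom_bound (g : G) :
  exists p : nat, forall x : M, x g \in `[- p%:R, p%:R].
Proof.
have [p p0 gp] := lunit_strong g; have [q q0 gq] := lunit_strong (- g).
exists (p + q)%N => x; have xh := (lhomE x).1 (Max_lhom x).
have x1 : x lunit = 1 by case: xh.
have := lhom_mono xh gp; have := lhom_mono xh gq.
rewrite lhomN// !lhomMn// x1 in_itv/= natrD => xq xp.
rewrite lerNl (le_trans xq) ?lerDr//=.
by rewrite (le_trans xp) ?lerDl.
Qed.

Lemma Max_compact : compact [set: M].
Proof.
rewrite compact_ultra => F FU _.
have FP : ProperFilter F by exact: ultra_proper.
have Fg (g : G) : exists l : R, (fun x : M => x g) @ F --> l.
  have [p gp] := lhom_bound g.
  have := @segment_compact R (- p%:R) p%:R.
  have imU : UltraFilter ((fun x : M => x g) @ F).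
    split; first exact: fmap_proper_filter.
    move=> H HP FH; apply/seteqP; split=> // A HA.
    have [//|FAC] := in_ultra_setVsetC ((fun x : M => x g) @^-1` A) FU.
    have : H (A `&` ~` A) by apply: filterI => //; exact: FH.
    by rewrite setICr => /filter_ex[].
  rewrite compact_ultra => /(_ _ imU) [|l [_ Fl]]; last by exists l.
  apply: (@filterS _ F _ setT) => [x _|]; [exact: gp|exact: filterT].
pose l g := projT1 (cid (Fg g)).
have lP g : (fun x : M => x g) @ F --> l g by exact: projT2 (cid (Fg g)).
have luniq (u v : R) (f : M -> R) : f @ F --> u -> f @ F --> v -> u = v.
  by apply: cvg_unique; exact: norm_hausdorff.
have lh : unital_lhom l.
  split=> [g h|g h|g h|].
  - apply: (luniq _ _ _ (lP (g - h))).
    rewrite (_ : (fun _ => _) = (fun x : M => x g) - (fun x : M => x h)).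
      by apply: cvgB; exact: lP.
    by apply/funext => x; have [xB _ _ _] := (lhomE x).1 (Max_lhom x); rewrite xB.
  - apply: (luniq _ _ _ (lP (lmeet g h))).
    rewrite (_ : (fun _ => _) = (fun x : M => Order.min (x g) (x h))).
      apply: (@continuous2_cvg _ _ _ _ F _ _ _ (fun a b : R => Order.min a b)) => //.
      by apply: (@continuous_min R (R * R)%type fst snd (l g, l h));
        [exact: cvg_fst|exact: cvg_snd].
    by apply/funext => x; have [_ xI _ _] := (lhomE x).1 (Max_lhom x); rewrite xI.
  - apply: (luniq _ _ _ (lP (ljoin g h))).
    rewrite (_ : (fun _ => _) = (fun x : M => Order.max (x g) (x h))).
      apply: (@continuous2_cvg _ _ _ _ F _ _ _ (fun a b : R => Order.max a b)) => //.
      by apply: (@continuous_max R (R * R)%type fst snd (l g, l h));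
        [exact: cvg_fst|exact: cvg_snd].
    by apply/funext => x; have [_ _ xU _] := (lhomE x).1 (Max_lhom x); rewrite xU.
  - apply: (luniq _ _ _ (lP lunit)).
    rewrite (_ : (fun _ => _) = cst 1); first exact: cvg_cst.
    by apply/funext => x; have [_ _ _ x1] := (lhomE x).1 (Max_lhom x).
exists (MkMax ((lhomE l).2 lh)); split=> //=.
apply: (subbase_cvg Max_openE) => _ [g [U [oU ->]]] Ul.
by apply: (lP g); exact: open_nbhs_nbhs.
Qed.

HB.instance Definition _ := isASpace.Build M Max_zeta_continuous.
HB.instance Definition _ := isCompactSpace.Build M Max_compact.

Lemma ev_amap (g : G) : amap (fun x : M => x g).
Proof.
by split=> x; [exact: ev_continuous|exact: (Max_zeta_dvd x _).1 (dvdnn _) g].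
Qed.

Definition epsilon (g : G) : Ca R M := MkCa ((amapE _).2 (ev_amap g)).

End Max.
Arguments epsilon R G g : clear implicits.

(* Main.v *)
Require Import Defs.
From mathcomp Require Import all_boot all_order all_algebra.
From mathcomp Require Import all_classical all_reals all_analysis.
From mathcomp Require Import lra.
Import Order.TTheory GRing.Theory Num.Theory.
Import numFieldNormedType.Exports.

Set Implicit Arguments.
Unset Strict Implicit.
Unset Printing Implicit Defensive.

Local Open Scope classical_set_scope.
Local Open Scope ring_scope.

(** Write Max G for the set of unital l-homomorphisms G -> R, and let R stand
for any realType.

There are enough points.  A maximal proper l-ideal of G, with positive cone I,
has an explicit point attached to it: the gauge
[x(g) = inf { m / n | n g <= m 1 + i, i in I }].  For every proper I the gauge
is subadditive, preserves joins and sends [m 1] to [m].  Maximality makes I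
prime, which forces [x(- g) = - x(g)], and so makes the gauge a homomorphism
([gauge_maximal_lhom]).  Applied to a maximal ideal containing the negative part
of b, this yields: if [x(b) < 0] at every point x, then [b <= 0]
([Max_neg_le0]).  In an Archimedean group the order is therefore pointwise on
Max G ([archimedean_Max_le]), and the norm given by the unit is the supremum
norm ([represented_unorm_le], [lhom_unorm]).

The evaluations are dense in the a-maps ([epsilon_dense]).  At one point x, the
set x(G) is a subgroup of R that contains 1, so it is either dense, or equal to
(1/n)Z; in the second case the denominator of x divides n, hence the value at x
of every a-map lies in x(G) ([one_point_approx]).  At two distinct points the
values can be prescribed independently, by truncating with an element that
vanishes at one of the points only ([two_point_interpolation]).  The lattice
form of the Stone-Weierstrass argument then gives uniform approximation: two
rounds of compactness, one for upper and one for lower bounds, each applied to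
a directed family ([compact_directed]).

Now metric completeness makes epsilon surjective, since an a-map is a uniform
limit of evaluations of a Cauchy sequence of elements of G; injectivity comes
from the pointwise order ([complete_epsilon_liso]).  Conversely C_a(X) is
complete because a uniform limit of a-maps is an a-map: for each n the reals r
with [n r] an integer form a closed set ([Ca_uniform_limit]).  As an
isomorphism reflects the order, this transfers to any group isomorphic to
C_a(X) ([Ca_liso_complete]). *)

(** * Arithmetic in Abelian lattice-ordered groups *)

Section LGroupAlgebra.
Variable G : unitalLGroupType.
Implicit Types x y z u v w : G.

Lemma ljoin_ub x y : x <= ljoin x y /\ y <= ljoin x y.
Proof. by apply/andP; rewrite -ljoinP. Qed.

Lemma lmeet_lb x y : lmeet x y <= x /\ lmeet x y <= y.
Proof. by apply/andP; rewrite -lmeetP. Qed.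

Lemma lg_lerD2l z x y : (z + x <= z + y) = (x <= y).
Proof.
apply/idP/idP => [/(@lg_leD2l _ _ _ (- z))|]; last exact: lg_leD2l.
by rewrite !addKr.
Qed.

Lemma lg_lerD2r z x y : (x + z <= y + z) = (x <= y).
Proof. by rewrite ![_ + z]addrC lg_lerD2l. Qed.

Lemma lg_lerBlDr x y z : (x - y <= z) = (x <= z + y).
Proof. by rewrite -(lg_lerD2r y (x - y)) subrK. Qed.

Lemma lg_lerBrDr x y z : (x <= y - z) = (x + z <= y).
Proof. by rewrite -(lg_lerD2r z x) subrK. Qed.

Lemma lg_subr_ge0 x y : (0 <= y - x) = (x <= y).
Proof. by rewrite lg_lerBrDr add0r. Qed.

Lemma lg_lerN2 x y : (- x <= - y) = (y <= x).
Proof. by rewrite -[LHS]lg_subr_ge0 opprK addrC lg_subr_ge0. Qed.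

Lemma lg_ler_wpDr x y z : 0 <= z -> x <= y -> x <= y + z.
Proof. by move=> z0 xy; rewrite -[x]addr0; exact: lg_leD. Qed.

Lemma lg_mulrn_ge0 x n : 0 <= x -> 0 <= x *+ n.
Proof. by move=> /(@lg_leMn _ _ _ n); rewrite mul0rn. Qed.

Lemma lg_ler_pMn x m n : 0 <= x -> (m <= n)%N -> x *+ m <= x *+ n.
Proof.
by move=> x0 mn; rewrite -(subnKC mn) mulrnDr lg_ler_wpDr// lg_mulrn_ge0.
Qed.

Lemma lmeet_opp_join x y : lmeet x y = - ljoin (- x) (- y).
Proof.
apply/le_anti/andP; split.
  have [h k] := lmeet_lb x y.
  by rewrite -lg_lerN2 opprK ljoinP !lg_lerN2 h.
have [h k] := ljoin_ub (- x) (- y).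
by rewrite lmeetP -(lg_lerN2 x) -(lg_lerN2 y) opprK h.
Qed.

Definition lpos x : G := ljoin x 0.

Lemma lpos_ge0 x : 0 <= lpos x.
Proof. exact: (ljoin_ub x 0).2. Qed.

Lemma le_lpos x : x <= lpos x.
Proof. exact: (ljoin_ub x 0).1. Qed.

Lemma lposN x : lpos (- x) = lpos x - x.
Proof.
apply/le_anti/andP; split.
  by rewrite ljoinP lg_lerBrDr addNr lpos_ge0 lg_subr_ge0 le_lpos.
rewrite lg_lerBlDr ljoinP -(lg_lerBlDr 0) sub0r le_lpos -{1}[x]add0r.
by rewrite lg_lerD2r lpos_ge0.
Qed.

Lemma ljoin_lpos x y : ljoin x y = y + lpos (x - y).
Proof.
apply/le_anti/andP; split.
  rewrite ljoinP [y + _]addrC -lg_lerBlDr le_lpos -{1}[y]add0r.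
  by rewrite lg_lerD2r lpos_ge0.
have [xj yj] := ljoin_ub x y.
by rewrite addrC -lg_lerBrDr ljoinP lg_lerD2r xj lg_subr_ge0.
Qed.

(** Disjointness of positive elements u and v is expressed throughout as
[lmeet u v <= 0]. *)
Lemma lpos_disjoint x : lmeet (lpos x) (lpos (- x)) <= 0.
Proof.
have [] := lmeet_lb (lpos x) (lpos (- x)); set w := lmeet _ _.
rewrite lposN => wx; rewrite lg_lerBrDr addrC -lg_lerBrDr => xw.
have : lpos x <= lpos x - w by rewrite ljoinP xw lg_subr_ge0.
by rewrite lg_lerBrDr -{2}[lpos x]addr0 lg_lerD2l.
Qed.

Lemma lmeet_disjointD u w v : 0 <= w ->
  lmeet u v <= 0 -> lmeet w v <= 0 -> lmeet (u + w) v <= 0.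
Proof.
move=> w0 uv; apply: le_trans.
have [zuw zv] := lmeet_lb (u + w) v; rewrite lmeetP zv andbT.
rewrite -[X in _ <= X]add0r -lg_lerBlDr; apply: le_trans uv; rewrite lmeetP.
by rewrite lg_lerBlDr zuw lg_lerBlDr lg_ler_wpDr.
Qed.

Lemma lmeet_disjointMn u v n : 0 <= u ->
  lmeet u v <= 0 -> lmeet (u *+ n) v <= 0.
Proof.
move=> u0 uv; elim: n => [|n IH]; first exact: (lmeet_lb _ _).1.
by rewrite mulrSr; exact: lmeet_disjointD.
Qed.

Lemma lmeetC x y : lmeet x y = lmeet y x.
Proof.
apply/le_anti/andP; split; rewrite lmeetP;
  by [have [-> ->] := lmeet_lb x y|have [-> ->] := lmeet_lb y x].
Qed.

Lemma lmeet_disjointMn2 u v n : 0 <= u -> 0 <= v ->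
  lmeet u v <= 0 -> lmeet (u *+ n) (v *+ n) <= 0.
Proof.
move=> u0 v0 uv; apply: lmeet_disjointMn => //; rewrite lmeetC.
by apply: lmeet_disjointMn => //; rewrite lmeetC.
Qed.

(** With d = x - y one has [ljoin x y = y + d^+ = x + d^-].  So if w denotes
[ljoin x y *+ n - z], the two hypotheses say that w lies below [d^+ *+ n] and
below [d^- *+ n], and these are disjoint. *)
Lemma ljoinMn_le x y z n : x *+ n <= z -> y *+ n <= z -> ljoin x y *+ n <= z.
Proof.
move=> xz yz; rewrite -lg_subr_ge0 -lg_lerN2 oppr0 opprB.
apply: le_trans (lmeet_disjointMn2 n (lpos_ge0 (x - y)) (lpos_ge0 _)
  (lpos_disjoint _)); rewrite lmeetP opprB.
have jC : ljoin x y = x + lpos (y - x).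
  rewrite ljoin_lpos -(opprB x) lposN opprB addrCA.
  by rewrite [x + (y - x)]addrC subrK addrC.
rewrite {1}ljoin_lpos jC !mulrnDl.
by rewrite !lg_lerBlDr ![_ + z]addrC !lg_lerD2r yz xz.
Qed.

Lemma lg_mulrn_le0 x n : (0 < n)%N -> x *+ n <= 0 -> x <= 0.
Proof.
move=> n0 xn; apply: le_trans (le_lpos x) _.
have : lpos x *+ n <= 0 by apply: ljoinMn_le => //; rewrite mul0rn.
by apply: le_trans; rewrite -{1}[lpos x]mulr1n lg_ler_pMn ?lpos_ge0.
Qed.

(** The strength of the unit, applied to [- lunit], bounds a positive multiple
of the unit from below by 0. *)
Lemma lunit_ge0 : 0 <= lunit :> G.
Proof.
have [p _] := lunit_strong (- lunit : G).
rewrite -[X in X <= _]sub0r lg_lerBlDr -mulrSr => h.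
rewrite -[lunit]opprK -oppr0 lg_lerN2; apply: (@lg_mulrn_le0 _ p.+1) => //.
by rewrite mulNrn -oppr0 lg_lerN2.
Qed.

Lemma lunitMz_le (m n : int) : m <= n -> lunit *~ m <= lunit *~ n :> G.
Proof.
move=> mn; rewrite -lg_subr_ge0 -mulrzBr.
have : 0 <= n - m by rewrite subr_ge0.
by case: (n - m) => // k _; rewrite -pmulrn lg_mulrn_ge0 ?lunit_ge0.
Qed.

End LGroupAlgebra.

(** * Ideals and their gauges *)

Lemma fraction_between (R : realType) (a b : R) : a < b ->
  exists (m : int) (n : nat),
    [/\ (0 < n)%N, a < m%:~R / n%:R & m%:~R / n%:R < b].
Proof.
move=> /rat_in_itvoo[q]; rewrite in_itv/= => /andP[aq qb].
have qE : ratr q = (numq q)%:~R / `|denq q|%N%:R :> R.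
  by rewrite -[in LHS](divq_num_den q) fmorph_div/= !ratr_int pmulrn absz_denq.
by exists (numq q), `|denq q|%N; rewrite absz_gt0 denq_neq0 -qE.
Qed.

Section Gauge.
Variables (R : realType) (G : unitalLGroupType).
Implicit Types (g h u v i j : G) (I : set G).

(** These sets are the positive cones of the proper convex l-subgroups of G. *)
Record proper_lideal I : Prop := ProperLIdeal {
  lideal0 : I 0;
  lideal_ge0 : forall i, I i -> 0 <= i;
  lidealD : forall i j, I i -> I j -> I (i + j);
  lideal_down : forall i j, 0 <= i -> i <= j -> I j -> I i;
  lideal_proper : ~ I lunit
}.

Definition gauge_set I g : set R :=
  [set r | exists (m : int) (n : nat) (i : G),
    [/\ (0 < n)%N, I i, r = m%:~R / n%:R & g *+ n <= lunit *~ m + i]].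

(** For I = {0} this is the upper norm; in general it is the upper norm of the
class of g modulo I. *)
Definition gauge I g : R := inf (gauge_set I g).

Variable I : set G.
Hypothesis pI : proper_lideal I.

Lemma lidealMn i n : I i -> I (i *+ n).
Proof.
move=> Ii; elim: n => [|n IH]; first exact: lideal0.
by rewrite mulrS; exact: lidealD.
Qed.

(** Otherwise - m >= 1, so the unit would lie below the element i of I. *)
Lemma lideal_le_lunit m i : I i -> 0 <= lunit *~ m + i -> 0 <= m.
Proof.
move=> Ii h; rewrite leNgt; apply/negP => m0; apply: (lideal_proper pI).
apply: (lideal_down pI (lunit_ge0 G) _ Ii); rewrite -[lunit]mulr1z.
apply: le_trans (@lunitMz_le G 1 (- m) _) _.
  by rewrite -gtz0_ge1 oppr_gt0.
by rewrite mulrNz -(lg_lerD2l (lunit *~ m)) subrr.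
Qed.

Lemma gauge_set_lbound g : has_lbound (gauge_set I g).
Proof.
have [k _ gk] := lunit_strong (- g); exists (- k%:R).
move=> r [m [n [i [n0 Ii -> gn]]]]; rewrite ler_pdivlMr ?ltr0n//.
have /(lideal_le_lunit Ii) : 0 <= lunit *~ (m + (k * n)%N%:Z) + i.
  rewrite mulrzDr addrAC -(subrr (g *+ n)); apply: lg_leD => //.
  by rewrite -mulNrn -pmulrn mulrnA; exact: lg_leMn.
by rewrite -(ler_int R) intrD -pmulrn natrM mulr0z; lra.
Qed.

Lemma gauge_set_neq0 g : gauge_set I g !=set0.
Proof.
have [k _ gk] := lunit_strong g; exists k%:R, k%:Z, 1%N, 0.
by rewrite addr0 divr1 -pmulrn mulr1n; split => //; exact: lideal0.
Qed.

Lemma gauge_le g m n i : (0 < n)%N -> I i -> g *+ n <= lunit *~ m + i ->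
  gauge I g <= m%:~R / n%:R.
Proof.
move=> n0 Ii gn; apply: ge_inf; first exact: gauge_set_lbound.
by exists m, n, i.
Qed.

Lemma gauge_lt g r : gauge I g < r -> exists m n i,
  [/\ (0 < n)%N, I i, m%:~R / n%:R < r & g *+ n <= lunit *~ m + i].
Proof.
move=> /inf_lt[|_ [m [n [i [n0 Ii -> gn]]]] mn]; first exact: gauge_set_neq0.
by exists m, n, i.
Qed.

Lemma gaugeD g h : gauge I (g + h) <= gauge I g + gauge I h.
Proof.
apply/ler_addgt0Pr => e e0.
have e2 : 0 < e / 2 by rewrite divr_gt0.
have /gauge_lt[m [n [i [n0 Ii mn gn]]]] : gauge I g < gauge I g + e / 2.
  by rewrite ltrDl.
have /gauge_lt[p [q [j [q0 Ij pq gq]]]] : gauge I h < gauge I h + e / 2.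
  by rewrite ltrDl.
have : gauge I (g + h) <= (m * q + p * n)%:~R / (n * q)%N%:R.
  apply: (@gauge_le _ _ _ (i *+ q + j *+ n)).
  - by rewrite muln_gt0 n0.
  - by apply: lidealD => //; exact: lidealMn.
  - rewrite mulrnDl mulrzDr addrACA; apply: lg_leD.
      rewrite mulrnA; apply: le_trans (lg_leMn q gn) _.
      by rewrite mulrnDl mulrzA -pmulrn.
    rewrite [(n * q)%N]mulnC mulrnA; apply: le_trans (lg_leMn n gq) _.
    by rewrite mulrnDl mulrzA -pmulrn.
move=> /le_trans; apply.
have -> : (m * q + p * n)%:~R / (n * q)%N%:R = m%:~R / n%:R + p%:~R / q%:R :> R.
  rewrite addf_div ?pnatr_eq0 -?lt0n// natrM intrD !intrM.
  by rewrite -!pmulrn.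
by lra.
Qed.

Lemma le_gauge g h : g <= h -> gauge I g <= gauge I h.
Proof.
move=> gh; apply/ler_addgt0Pr => e e0.
have /gauge_lt[m [n [i [n0 Ii /ltW mn hn]]]] : gauge I h < gauge I h + e.
  by rewrite ltrDl.
apply: le_trans mn; apply: (gauge_le n0 Ii).
exact: le_trans (lg_leMn n gh) hn.
Qed.

(** Over a common denominator N, upper bounds of g and h become
[g *+ N <= M 1 + J] and [h *+ N <= M 1 + J] with the same M and J, and
[ljoinMn_le] transfers them to the join. *)
Lemma gauge_join g h :
  gauge I (ljoin g h) = Num.max (gauge I g) (gauge I h).
Proof.
apply/le_anti; rewrite ge_max.
have [jg jh] := ljoin_ub g h; rewrite !le_gauge// !andbT.
apply/ler_addgt0Pr => e e0; set r := _ + e.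
have [gr hr] : gauge I g < r /\ gauge I h < r.
  by apply/andP; rewrite -gt_max ltrDl.
have [m [n [i [n0 Ii mn gn]]]] := gauge_lt gr.
have [p [q [j [q0 Ij pq hq]]]] := gauge_lt hr.
have mE : (m * q)%:~R / (n * q)%N%:R = m%:~R / n%:R :> R.
  by rewrite intrM natrM -pmulrn -mulf_div divff ?mulr1// pnatr_eq0 -lt0n.
have pE : (p * n)%:~R / (n * q)%N%:R = p%:~R / q%:R :> R.
  by rewrite mulnC intrM natrM -pmulrn -mulf_div divff ?mulr1// pnatr_eq0 -lt0n.
have i0 := lg_mulrn_ge0 q (lideal_ge0 pI Ii).
have j0 := lg_mulrn_ge0 n (lideal_ge0 pI Ij).
have : gauge I (ljoin g h) <= (Num.max (m * q) (p * n))%:~R / (n * q)%N%:R.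
  apply: (@gauge_le _ _ _ (i *+ q + j *+ n)).
  - by rewrite muln_gt0 n0.
  - by apply: lidealD => //; exact: lidealMn.
  - apply: ljoinMn_le.
      rewrite mulrnA; apply: le_trans (lg_leMn q gn) _.
      rewrite mulrnDl; apply: lg_leD; last exact: lg_ler_wpDr.
      by rewrite pmulrn -mulrzA lunitMz_le// le_max lexx.
    rewrite mulnC mulrnA; apply: le_trans (lg_leMn n hq) _.
    rewrite mulrnDl [i *+ q + _]addrC; apply: lg_leD; last exact: lg_ler_wpDr.
    by rewrite pmulrn -mulrzA lunitMz_le// le_max lexx orbT.
by move=> /le_trans; apply; rewrite /Num.max; case: ifP => _;
  rewrite ?mE ?pE ltW.
Qed.

Lemma gauge_lunitMz m : gauge I (lunit *~ m) = m%:~R.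
Proof.
apply/le_anti/andP; split.
  have := @gauge_le (lunit *~ m) m 1 0 isT (lideal0 pI).
  by rewrite divr1 addr0 mulr1n; apply.
apply: lb_le_inf; first exact: gauge_set_neq0.
move=> r [p [n [i [n0 Ii -> gn]]]]; rewrite ler_pdivlMr ?ltr0n//.
rewrite [n%:R]pmulrn -intrM ler_int -subr_ge0; apply: (lideal_le_lunit Ii).
rewrite mulrzBr addrAC lg_subr_ge0.
by rewrite mulrzA -pmulrn.
Qed.

(* Maximality of I: adjoining a positive element outside I captures the unit. *)
Hypothesis maxI : forall u, 0 <= u -> ~ I u ->
  exists n i, I i /\ lunit <= u *+ n + i.

(** If neither u nor v is in I, then multiples of u and of v both dominate the
unit modulo I; since these multiples are disjoint, the unit would be in I. *)
Lemma maximal_lideal_prime u v : 0 <= u -> 0 <= v -> lmeet u v <= 0 ->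
  I u \/ I v.
Proof.
move=> u0 v0 uv.
have [Iu|/(maxI u0)[n [i [Ii un]]]] := pselect (I u); first by left.
have [Iv|/(maxI v0)[p [j [Ij vp]]]] := pselect (I v); first by right.
exfalso; apply: (lideal_proper pI).
apply: (lideal_down pI (lunit_ge0 G) _ (lidealD pI Ii Ij)).
have := lmeet_disjointMn2 (n + p) u0 v0 uv.
have : lunit - (i + j) <= lmeet (u *+ (n + p)) (v *+ (n + p)).
  have [i0 j0] := (lideal_ge0 pI Ii, lideal_ge0 pI Ij).
  rewrite lmeetP !lg_lerBlDr; apply/andP; split.
    apply: le_trans un _; apply: lg_leD; last exact: lg_ler_wpDr.
    exact: lg_ler_pMn (leq_addr _ _).
  apply: le_trans vp _; apply: lg_leD; first exact: lg_ler_pMn (leq_addl _ _).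
  by rewrite addrC lg_ler_wpDr.
by move=> /le_trans /[apply]; rewrite lg_lerBlDr add0r.
Qed.

(** Were [- gauge (- g) < m / n < gauge g], the element b = n g - m 1 would have
neither its positive nor its negative part in I, as either membership gives the
opposite bound on the gauge of g or of - g.  But these two parts are disjoint
and I is prime. *)
Lemma gauge_maximalN g : gauge I (- g) = - gauge I g.
Proof.
apply/eqP; rewrite -subr_eq0 opprK; apply/eqP/le_anti/andP; split; last first.
  by have := gaugeD (- g) g; rewrite addNr -(mulr0z lunit) gauge_lunitMz.
rewrite leNgt; apply/negP => gg.
have /fraction_between[m [n [n0 gl gr]]] : - gauge I (- g) < gauge I g by lra.
pose b := g *+ n - lunit *~ m.
have [Ib|Ib] := maximal_lideal_prime (lpos_ge0 b) (lpos_ge0 _)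
  (lpos_disjoint b).
  have : gauge I g <= m%:~R / n%:R.
    apply: (gauge_le n0 Ib).
    by rewrite addrC -lg_lerBlDr le_lpos.
  by rewrite leNgt gr.
have : gauge I (- g) <= (- m)%:~R / n%:R.
  apply: (gauge_le n0 Ib).
  by rewrite addrC -lg_lerBlDr mulrNz opprK mulNrn addrC -opprB le_lpos.
by rewrite mulrNz mulNr; lra.
Qed.

Lemma gauge_maximal_lhom : unital_lhom (gauge I).
Proof.
have gD g h : gauge I (g + h) = gauge I g + gauge I h.
  apply/le_anti; rewrite gaugeD/=.
  by have := gaugeD (g + h) (- h); rewrite addrK gauge_maximalN; lra.
split=> [g h|g h|g h|].
- by rewrite gD gauge_maximalN.
- rewrite lmeet_opp_join !gauge_maximalN gauge_join !gauge_maximalN.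
  by rewrite -oppr_min opprK.
- by rewrite gauge_join /ljoin/= maxC.
- by rewrite -[lunit]mulr1z gauge_lunitMz.
Qed.

End Gauge.

Section MaximalLIdeal.
Variable G : unitalLGroupType.
Implicit Types (u i : G) (I : set G).

(** Zorn gives a maximal I; for u outside I, the ideal generated by I and u is
strictly larger, so it is not proper. *)
Lemma maximal_lideal_exists I0 : proper_lideal I0 ->
  exists I, [/\ proper_lideal I, I0 `<=` I &
    forall u, 0 <= u -> ~ I u -> exists n i, I i /\ lunit <= u *+ n + i].
Proof.
move=> pI0.
(* The empty set is admitted as well, to be the union of the empty chain. *)
pose P (J : set G) := J = set0 \/ proper_lideal J /\ I0 `<=` J.
have [F FP Ftot|I [PI Imax]] := @Zorn_bigcup G P.
  have [[J0 [FJ0 J00]]|F0] := pselect (exists J, F J /\ J <> set0); last first.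
    left; apply/seteqP; split=> // x [J FJ Jx].
    have J0 : J <> set0 by move=> J0; rewrite J0 in Jx.
    by apply: F0; exists J.
  have Fp J x : F J -> J x -> proper_lideal J /\ I0 `<=` J.
    by move=> /FP[->|].
  have [//|[pJ0 IJ0]] := FP _ FJ0.
  right; split; last by move=> x /IJ0 J0x; exists J0.
  split.
  - by exists J0 => //; exact: lideal0.
  - by move=> i [J FJ Ji]; have [pJ _] := Fp _ _ FJ Ji; exact: lideal_ge0 Ji.
  - move=> i j [J FJ Ji] [K FK Kj].
    have [pJ _] := Fp _ _ FJ Ji; have [pK _] := Fp _ _ FK Kj.
    have [JK|KJ] := Ftot _ _ FJ FK.
      by exists K => //; apply: lidealD => //; exact: JK.
    by exists J => //; apply: lidealD => //; exact: KJ.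
  - move=> i j i0 ij [J FJ Jj]; have [pJ _] := Fp _ _ FJ Jj.
    by exists J => //; exact: lideal_down Jj.
  - by move=> [J FJ J1]; have [pJ _] := Fp _ _ FJ J1; exact: (lideal_proper pJ).
have {PI}[pI I0I] : proper_lideal I /\ I0 `<=` I.
  case: PI => [I_0|//]; exfalso; apply: (Imax I0); last by right; split.
  rewrite I_0 properEneq; split; last exact: sub0set.
  by apply/eqP => e; have := lideal0 pI0; rewrite -e.
exists I; split=> // u u0 Iu.
apply: contrapT => noI.
pose J : set G := [set x | 0 <= x /\ exists n i, I i /\ x <= u *+ n + i].
have IJ : I `<=` J.
  move=> x Ix; split; first exact: lideal_ge0 Ix.
  by exists 0%N, x; split => //; rewrite add0r.
apply: (Imax J).
  rewrite properEneq; split=> //; apply/eqP => e; apply: Iu; rewrite e.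
  by split=> //; exists 1%N, 0; split; [exact: lideal0|rewrite addr0].
right; split; last exact: subset_trans IJ.
split.
- by apply: IJ; exact: lideal0.
- by move=> i [].
- move=> x y [x0 [n [i [Ii xn]]]] [y0 [p [j [Ij yp]]]]; split.
    exact: lg_ler_wpDr.
  exists (n + p)%N, (i + j); split; first exact: lidealD.
  by rewrite mulrnDr addrACA lg_leD.
- move=> x y x0 xy [_ [n [i [Ii yn]]]]; split=> //; exists n, i; split=> //.
  exact: le_trans yn.
- by move=> [_ h]; exact: noI.
Qed.

End MaximalLIdeal.

Section Separation.
Variables (R : realType) (G : unitalLGroupType).

(** If the ideal generated by the negative part of b is proper, a point that
vanishes on it satisfies [x b >= 0].  If it is not proper, then some multiple
of the negative part dominates the unit, hence up to a further multiple the
positive part; being disjoint from it, the positive part is 0. *)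
Lemma Max_neg_le0 (b : G) : (forall x : Max R G, x b < 0) -> b <= 0.
Proof.
move=> bneg; apply: contrapT => nb.
pose I0 : set G := [set w | 0 <= w /\ exists n, w <= lpos (- b) *+ n].
have pI0 : proper_lideal I0.
  split.
  - by split=> //; exists 0%N.
  - by move=> i [].
  - move=> i j [i0 [n ni]] [j0 [p pj]]; split; first exact: lg_ler_wpDr.
    by exists (n + p)%N; rewrite mulrnDr; exact: lg_leD.
  - move=> i j i0 ij [_ [n jn]]; split=> //; exists n; exact: le_trans jn.
  - move=> [_ [n n1]]; apply: nb; apply: le_trans (le_lpos b) _.
    have [k _ bk] := lunit_strong (lpos b).
    have : lmeet (lpos (- b) *+ (n * k)) (lpos b) <= 0.
      by rewrite lmeet_disjointMn ?lpos_ge0// lmeetC lpos_disjoint.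
    apply: le_trans; rewrite lmeetP lexx andbT mulrnA.
    by apply: le_trans bk _; exact: lg_leMn.
have [I [pI I0I Imax]] := maximal_lideal_exists pI0.
have xh := gauge_maximal_lhom R pI Imax.
have := bneg (MkMax ((lhomE _).2 xh)); rewrite /= ltNge => /negP; apply.
rewrite -oppr_le0 -(gauge_maximalN R pI Imax).
have Ib : I (lpos (- b)).
  by apply: I0I; split; [exact: lpos_ge0|exists 1%N].
have := @gauge_le R G I pI (- b) 0 1 _ isT Ib.
by rewrite mulr0z mulr0z mul0r add0r mulr1n; apply; exact: le_lpos.
Qed.

End Separation.

(** * Homomorphisms and the unit norm *)

Section LHom.
Variables (R : realType) (G : unitalLGroupType) (x : G -> R).
Hypothesis xh : unital_lhom x.

Lemma lhomB : {morph x : g h / g - h}.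
Proof. by case: xh. Qed.

Lemma lhom_meet : {morph x : g h / lmeet g h >-> Num.min g h}.
Proof. by case: xh. Qed.

Lemma lhom_join : {morph x : g h / ljoin g h >-> Num.max g h}.
Proof. by case: xh. Qed.

Lemma lhom_unit : x lunit = 1.
Proof. by case: xh. Qed.

Lemma lhom0 : x 0 = 0.
Proof. by rewrite -(subrr 0) lhomB subrr. Qed.

Lemma lhom_labs g : x (labs g) = `|x g|.
Proof. by rewrite /labs lhom_join (lhomN xh) maxrN. Qed.

Lemma lhom_unorm g : `|x g| <= unorm R g.
Proof.
apply: lb_le_inf; first exact: unorm_set_neq0.
move=> r [p [q [q0 -> gp]]]; rewrite ler_pdivlMr ?ltr0n//.
have := lhom_mono xh gp; rewrite !(lhomMn _ xh) lhom_labs lhom_unit.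
by rewrite mulr_natr.
Qed.

Lemma lhomMz (m : int) g : x (g *~ m) = x g * m%:~R.
Proof.
case: m => m; first by rewrite -pmulrn (lhomMn _ xh) -mulr_natr.
rewrite NegzE !mulrNz mulrN -!pmulrn (lhomN xh) (lhomMn _ xh).
by rewrite -mulr_natr.
Qed.

End LHom.

Lemma Max_hom (R : realType) (G : unitalLGroupType) (x : Max R G) :
  unital_lhom x.
Proof. exact: (lhomE x).1 (Max_lhom x). Qed.

Lemma lhom_comp (R : realType) (G H : unitalLGroupType)
    (f : G -> H) (x : H -> R) :
  unital_lhom f -> unital_lhom x -> unital_lhom (x \o f).
Proof.
move=> [fB fI fU f1] [xB xI xU x1].
by split=> [g h|g h|g h|] /=; rewrite ?(fB, fI, fU, f1) ?(xB, xI, xU, x1).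
Qed.

Lemma lhom_inj_le (G H : unitalLGroupType) (f : G -> H) :
  unital_lhom f -> injective f -> forall g h, f g <= f h -> g <= h.
Proof.
move=> [_ fI _ _] finj g h fgh.
have : f (lmeet g h) = f g.
  have [fm _] := lmeet_lb (f g) (f h).
  by apply/le_anti; rewrite fI fm lmeetP lexx.
by move=> /finj <-; have [_] := lmeet_lb g h.
Qed.

(* A family of points that determines the order.  Evaluations on C_a(X), pulled
   back along an isomorphism, form one; all points of Max G form another when G
   is Archimedean. *)
Section Representation.
Variables (R : realType) (G : unitalLGroupType) (X : Type) (F : X -> G -> R).
Hypothesis Fh : forall t, unital_lhom (F t).
Hypothesis Fle : forall g h, (forall t, F t g <= F t h) -> g <= h.

Lemma represented_unorm_le g (r : R) : 0 <= r ->
  (forall t, `|F t g| <= r) -> unorm R g <= r.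
Proof.
move=> r0 gr; apply/ler_addgt0Pr => e e0.
have /fraction_between[m [n [n0 rm /ltW]]] : r < r + e by rewrite ltrDl.
apply: le_trans.
case: m rm => p rm; last first.
  have : (Negz p)%:~R / n%:R <= 0 :> R.
    by rewrite pmulr_lle0 ?invr_gt0 ?ltr0n// NegzE mulrNz oppr_le0 ler0z.
  by move=> /(lt_le_trans rm) /(le_lt_trans r0); rewrite ltxx.
apply: ge_inf; first by exists 0; exact: unorm_set_ge0.
exists p, n; split=> //.
apply: Fle => t; rewrite !(lhomMn _ (Fh t)) lhom_labs// lhom_unit//.
rewrite -mulr_natr -ler_pdivlMr ?ltr0n//.
by apply: le_trans (gr t) (ltW rm).
Qed.

Lemma represented_archimedean : archimedean_lgroup G.
Proof.
move=> g h gh; apply: Fle => t; rewrite lhom0// leNgt; apply/negP => gt0.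
have := archi_boundP (normr_ge0 (F t h / F t g)).
set p := Num.bound _ => hp.
have /(lhom_mono (Fh t)) := gh p.+1 isT.
rewrite lhomMn// leNgt => /negP; apply.
rewrite -mulr_natr mulrC -ltr_pdivrMr//.
by rewrite (le_lt_trans (ler_norm _))// (lt_trans hp)// ltr_nat.
Qed.

End Representation.

(** * Metric completeness of groups of a-maps *)

Section CaComplete.
Variables (R : realType) (X : compactASpaceType).

Lemma Ca_ev_lhom (t : X) : unital_lhom (fun f : Ca R X => f t).
Proof. by split. Qed.

(** Continuity is the usual three-epsilon argument.  For the denominators, with
n = zeta t, each [n * f k t] is an integer, and the integers are closed. *)
Lemma Ca_uniform_limit (f : nat -> Ca R X) (L : X -> R) :
  (forall e, 0 < e -> exists N, forall n, (N <= n)%N ->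
     forall t, `|f n t - L t| <= e) -> amap L.
Proof.
move=> fL; split=> t.
  apply/cvgrPdist_lt => e e0.
  have e3 : 0 < e / 3 by rewrite divr_gt0.
  have [N /(_ N (leqnn N)) NL] := fL _ e3.
  have [fc _] := (amapE _).1 (Ca_amap (f N)).
  have /cvgrPdist_lt /(_ _ e3) := fc t.
  apply: filterS => s fts.
  have -> : L t - L s = (L t - f N t) + (f N t - f N s) + (f N s - L s) by lra.
  apply: le_lt_trans (ler_normD _ _) _.
  apply: le_lt_trans (lerD (ler_normD _ _) (lexx _)) _.
  have := NL t; have := NL s; rewrite [`|L t - _|]distrC; lra.
rewrite zeta_real den_dvd.
have cvgL : (fun n => f n t) @ \oo --> L t.
  apply/cvgrPdist_le => e e0; have [N NL] := fL e e0.
  by exists N => // n /= Nn; rewrite distrC; exact: NL.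
apply: (closed_cvg [set r : R | r \is a Num.int] (@int_closed R) _ _
  (continuous_cvg _ (@mulnr_continuous R (zeta t) (L t)) cvgL)).
apply: nearW => n /=; rewrite -den_dvd.
by have [_] := (amapE _).1 (Ca_amap (f n)); exact.
Qed.

Lemma cauchy_unorm (G : unitalLGroupType) (u : nat -> unit_metric R G) :
  cauchy (u @ \oo) -> forall e, 0 < e -> exists N, forall m n,
    (N <= m)%N -> (N <= n)%N -> unorm R (u m - u n : G) < e.
Proof.
move=> /cauchy_ballP uC e e0.
have [[A B] /= [[N1 _ NA] [N2 _ NB]] AB] := uC e e0.
exists (maxn N1 N2) => m n; rewrite !geq_max => /andP[m1 _] /andP[_ n2].
by apply: (AB (u m, u n)); split; [exact: NA|exact: NB].
Qed.

Lemma cvg_unorm (G : unitalLGroupType) (u : nat -> unit_metric R G)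
    (l : unit_metric R G) :
  u @ \oo --> l <-> forall e, 0 < e -> exists N, forall n,
    (N <= n)%N -> unorm R (l - u n : G) < e.
Proof.
split=> [/cvg_ballP ul e /ul[N _ NU]|ul]; first by exists N => n /NU.
by apply/cvg_ballP => e /ul[N NU]; exists N => // n /NU.
Qed.

(** The pointwise limits of a Cauchy sequence exist and are attained uniformly,
because the norm bounds every value; the preimage of the limit is a limit in G
because, conversely, the values bound the norm. *)
Lemma Ca_liso_complete (G : unitalLGroupType) (f : G -> Ca R X) :
  unital_liso f -> metrically_complete R G.
Proof.
move=> [fh fbij]; have finj := bij_inj fbij.
pose F t g := f g t.
have Fh t : unital_lhom (F t) by exact: (lhom_comp fh (Ca_ev_lhom t)).
have Fle g h : (forall t, F t g <= F t h) -> g <= h.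
  by move=> gh; apply: (lhom_inj_le fh finj); apply/Ca_leP.
split; first exact: (represented_archimedean Fh Fle).
move=> u /cauchy_unorm uC.
have FC e : 0 < e -> exists N, forall m n, (N <= m)%N -> (N <= n)%N ->
    forall t, `|F t (u m) - F t (u n)| < e.
  move=> /uC[N NC]; exists N => m n Nm Nn t; rewrite -lhomB//.
  by apply: le_lt_trans (NC m n Nm Nn); exact: lhom_unorm.
have ucvg t : cvg ((fun n => F t (u n)) @ \oo).
  apply/cauchy_cvgP/cauchy_exP => e /FC[N NC].
  by exists (F t (u N)), N => // n /= Nn; exact: NC.
pose L t := lim ((fun n => F t (u n)) @ \oo).
have FL e : 0 < e -> exists N, forall n, (N <= n)%N ->
    forall t, `|F t (u n) - L t| <= e.
  move=> /FC[N NC]; exists N => n Nn t.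
  have cL : (fun m => `|F t (u n) - F t (u m)|) @ \oo --> `|F t (u n) - L t|.
    apply: cvg_norm; apply: cvgB; first exact: cvg_cst.
    exact: ucvg.
  apply: (cvgr_to_le cL); exists N => // m /= Nm.
  by apply: ltW; exact: NC.
have La : amap L by exact: (@Ca_uniform_limit (fun n => f (u n))).
have [f' _ fK] := fbij.
exists (f' (MkCa ((amapE _).2 La))); apply/cvg_unorm => e e0.
have e2 : 0 < e / 2 by rewrite divr_gt0.
have [N NL] := FL _ e2; exists N => n Nn.
apply: (@le_lt_trans _ _ (e / 2)); last lra.
apply: (represented_unorm_le Fh Fle); first exact: ltW.
by move=> t; rewrite lhomB// {1}/F fK /= distrC; exact: NL.
Qed.

End CaComplete.

(** * Density of the evaluations *)

Section Density.
Variables (R : realType) (G : unitalLGroupType).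
Local Notation M := (Max R G).
Implicit Types (x y : M) (g h : G).

(** If x(G) has an element in ]0, e[, its integer multiples are e-dense.  If
not, the infimum of the positive part of x(G) is attained at some d, so that
x(G) = x(d) Z; as 1 is in x(G), x(d) is the inverse of an integer m1, and
den r | zeta x | m1 puts r itself in x(G). *)
Lemma one_point_approx x (r e : R) : 0 < e -> (den r %| zeta x)%N ->
  exists g, `|x g - r| < e.
Proof.
move=> e0 rx; have xh := Max_hom x.
have near_mul g (s : R) : 0 < x g -> exists m : int, 0 <= s - x (g *~ m) < x g.
  move=> g0; exists (Num.floor (s / x g)).
  have /andP[] := floor_itv (s / x g).
  rewrite lhomMz// ler_pdivlMr// ltr_pdivrMr// intrD mulrDl mul1r mulrC; lra.
have [[g [g0 ge]]|disc] := pselect (exists g, 0 < x g /\ x g < e).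
  have [m /andP[m0 m1]] := near_mul g r g0.
  by exists (g *~ m); rewrite distrC ger0_norm// (lt_trans m1).
have disce g : 0 < x g -> e <= x g.
  by move=> g0; rewrite leNgt; apply/negP => ge; apply: disc; exists g.
pose S : set R := [set x g | g in [set g | 0 < x g]].
have S1 : S 1 by exists lunit; rewrite /= lhom_unit.
have Se : lbound S e by move=> _ [g g0 <-]; exact: disce.
have hinfS : has_inf S by split; [exists 1|exists e].
have infe : e <= inf S by apply: lb_le_inf => //; exists 1.
have inf_le g : 0 < x g -> inf S <= x g.
  by move=> g0; apply: ge_inf; [exists e|exists g].
have [d dE] : exists d, x d = inf S.
  have [_ [h h0 <-] hS] := inf_adherent (lt_le_trans e0 infe) hinfS.
  exists h; apply/le_anti; rewrite inf_le// andbT leNgt; apply/negP => hgt.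
  (* A second value x k, with inf S <= x k < x h, differs from x h by less
     than inf S, because x h < 2 inf S. *)
  have [_ [k k0 <-] kS] : exists2 s, S s & s < x h.
    by apply: inf_lt => //; exists 1.
  have := inf_le (h - k); rewrite lhomB// subr_gt0 => /(_ kS).
  by have := inf_le k k0; lra.
have d0 : 0 < x d by rewrite dE (lt_le_trans e0).
have mulE g : exists m : int, x g = x (d *~ m).
  have [m /andP[m0 m1]] := near_mul d (x g) d0; exists m.
  apply/eqP; rewrite -subr_eq0 eq_le m0 andbT leNgt; apply/negP => gm.
  have := inf_le (g - d *~ m); rewrite lhomB// => /(_ gm).
  by rewrite -dE leNgt m1.
have [m1 m1E] := mulE lunit; rewrite lhom_unit// lhomMz// in m1E.
have m1gt0 : 0 < m1.
  by rewrite -(ltr0z R) -(pmulr_rgt0 _ d0) -m1E.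
have zx : (zeta x %| `|m1|)%N.
  apply/Max_zeta_dvd => g; rewrite den_dvd; have [m ->] := mulE g.
  rewrite lhomMz// pmulrn gtz0_abs// mulrA [_ * x d]mulrC -m1E mul1r.
  exact: intr_int.
have := dvdn_trans rx zx; rewrite den_dvd pmulrn gtz0_abs// => /intrP[m mr].
exists (d *~ m); rewrite lhomMz// -mr mulrA -m1E mul1r subrr normr0//.
Qed.

(** Some g has [y g < m / n < x g]; take the positive part of n g - m 1. *)
Lemma Max_separate x y : x <> y -> exists h, [/\ 0 <= h, 0 < x h & y h = 0].
Proof.
move=> xy; have [xh yh] := (Max_hom x, Max_hom y).
have [g gxy] : exists g, y g < x g.
  have [g /eqP] : exists g, x g <> y g.
    apply: contrapT => nex; apply: xy; apply: val_inj; apply/funext => g.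
    by apply: contrapT => xyg; apply: nex; exists g.
  rewrite neq_lt => /orP[xg|yg]; last by exists g.
  by exists (- g); rewrite !lhomN// ltrN2.
have [m [n [n0]]] := fraction_between gxy.
rewrite ltr_pdivlMr ?ltr0n// ltr_pdivrMr ?ltr0n// => gy gx.
have ev (z : G -> R) : unital_lhom z ->
    z (lpos (g *+ n - lunit *~ m)) = Num.max (z g * n%:R - m%:~R) 0.
  move=> zh; rewrite lhom_join// lhomB// lhomMn// lhomMz// lhom_unit// mul1r.
  by rewrite lhom0// mulr_natr.
exists (lpos (g *+ n - lunit *~ m)); split; first exact: lpos_ge0.
  by rewrite ev// lt_max subr_gt0 gx.
by rewrite ev//; apply/max_idPr; rewrite subr_le0 ltW.
Qed.

(** Let s >= 0 be positive at x and zero at y.  Truncating the positive and the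
negative part of g - h by a large multiple of s keeps their values at x and
kills them at y; add the result to h. *)
Lemma two_point_interpolation x y g h : x <> y ->
  exists k, x k = x g /\ y k = y h.
Proof.
move=> /Max_separate[s [s0 xs ys]]; have [xh yh] := (Max_hom x, Max_hom y).
pose d := g - h.
have [n ns] : exists n : nat, `|x d| <= x s * n%:R.
  exists (Num.bound (`|x d| / x s)).
  rewrite mulrC -ler_pdivrMr//; apply/ltW/archi_boundP.
  by rewrite divr_ge0// ltW.
pose cut (w : G) := lmeet (lpos w) (s *+ n).
have ycut w : y (cut w) = 0.
  rewrite lhom_meet// lhom_join// lhomMn// ys mul0rn lhom0//.
  by apply/min_idPr; rewrite le_max lexx orbT.
have xcut w : `|x w| <= x s * n%:R -> x (cut w) = x (lpos w).
  move=> wn; rewrite lhom_meet//; apply/min_idPl.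
  rewrite lhom_join// lhomMn// lhom0// ge_max -mulr_natr.
  by rewrite (le_trans (ler_norm _) wn) (le_trans _ wn).
exists (h + (cut d - cut (- d))).
rewrite (lhomD xh) (lhomD yh) (lhomB xh) (lhomB yh) !ycut subrr addr0.
split=> //; rewrite !xcut ?(lhomN xh) ?normrN// lposN lhomB//.
by rewrite /d lhomB//; lra.
Qed.

Lemma two_point_approx (f : Ca R M) x y (e : R) : 0 < e ->
  exists g, `|x g - f x| < e /\ `|y g - f y| < e.
Proof.
move=> e0; have [_ fz] := (amapE _).1 (Ca_amap f).
have [g gx] := one_point_approx e0 (fz x).
have [h hy] := one_point_approx e0 (fz y).
have [xy|xy] := pselect (x = y); first by exists g; rewrite -xy.
have [k [xk yk]] := two_point_interpolation g h xy.
by exists k; rewrite xk yk.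
Qed.

End Density.

(** Compactness by near-coverings, for the filter on T generated by the sets of
the t in D that dominate a given s in D. *)
Lemma compact_directed (X : topologicalType) (T : Type) (D : set T)
    (P : T -> X -> Prop) :
  compact [set: X] -> D !=set0 ->
  (forall s t, D s -> D t ->
    exists2 r, D r & forall z, P s z \/ P t z -> P r z) ->
  (forall z : X, exists2 t, D t & \forall z' \near z, P t z') ->
  exists2 t, D t & forall z, P t z.
Proof.
move=> /compact_near_coveringP Xc [t0 Dt0] Ddir Dcov.
pose B s : set T := [set t | D t /\ forall z, P s z -> P t z].
have FF : Filter (filter_from D B).
  apply: filter_from_filter; first by exists t0.
  move=> s t Ds Dt; have [r Dr rP] := Ddir s t Ds Dt.
  by exists r => // u [Du ru]; split; split => // z Pz;
    apply/ru/rP; [left|right].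
have [z _|s Ds sP] := Xc T (filter_from D B) P FF.
  have [s Ds sz] := Dcov z.
  exists ([set z' | P s z'], B s); first by split => //; exists s.
  by move=> [z' t] [/= Pz' [_ st]]; exact: st.
have [Ps Bs] : B s s by split.
by exists s => // z; exact: (sP s).
Qed.

(** The constant c is kept apart from f and g so that the lemma applies to
evaluations as they stand. *)
Lemma near_lt_continuous (R : realType) (X : topologicalType) (f g : X -> R)
    (c : R) y : continuous f -> continuous g ->
  f y < g y + c -> \forall z \near y, f z < g z + c.
Proof.
move=> fc gc fgy; have : (fun z => g z + c - f z) @ y --> g y + c - f y.
  apply: cvgB; last exact: fc.
  by apply: cvgD; [exact: gc|exact: cvg_cst].
move=> /cvgrPdist_lt /(_ (g y + c - f y)).
rewrite subr_gt0 => /(_ fgy); apply: filterS => z.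
by rewrite ltr_norml => /andP[_]; lra.
Qed.

(** * Completeness makes epsilon an isomorphism *)

Section EpsilonIso.
Variables (R : realType) (G : unitalLGroupType).
Local Notation M := (Max R G).

(** The elements of G below f + e are directed upwards under joins; every y has
one that is above f - e near y, and so one of them is above f - e everywhere.
That elements below f + e with a good value at x exist is the dual argument,
with meets, for the elements of G that are above f - e at x. *)
Lemma epsilon_dense (f : Ca R M) (e : R) : 0 < e ->
  exists g, forall x : M, `|x g - f x| < e.
Proof.
move=> e0; have [fc _] := (amapE _).1 (Ca_amap f).
have upper (x : M) : exists2 g, f x - e < x g & forall y : M, y g < f y + e.
  apply: (@compact_directed M G (fun g => f x - e < x g)
    (fun g y => y g < f y + e)); first exact: compact_space.
  - have [g [gx _]] := two_point_approx f x x e0; exists g => /=.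
    by move: gx; rewrite distrC ltr_norml => /andP[_]; lra.
  - move=> g h /= gx hx; exists (lmeet g h).
      by rewrite (lhom_meet (Max_hom x)) lt_min gx.
    move=> y; rewrite (lhom_meet (Max_hom y)) gt_min.
    by move=> [->|->]//; rewrite orbT.
  - move=> y; have [g []] := two_point_approx f x y e0.
    rewrite !ltr_norml => /andP[gx _] /andP[_ gy].
    exists g; first by move: gx; lra.
    apply: (near_lt_continuous (@ev_continuous R G g) fc).
    by rewrite -ltrBlDl.
have [g gup glow] : exists2 g, forall y : M, y g < f y + e &
    forall y : M, f y - e < y g.
  apply: (@compact_directed M G (fun g => forall y : M, y g < f y + e)
    (fun g y => f y - e < y g)); first exact: compact_space.
  - have [p _ /Ca_leP fp] := lunit_strong (- f); exists (- (lunit *+ p)) => y.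
    have evh := Ca_ev_lhom R y; have yh := Max_hom y.
    have := fp y; rewrite (lhomN evh) (lhomMn _ evh) (lhom_unit evh).
    by rewrite (lhomN yh) (lhomMn _ yh) (lhom_unit yh); lra.
  - move=> g h /= gx hx; exists (ljoin g h).
      by move=> y; rewrite (lhom_join (Max_hom y)) gt_max gx hx.
    move=> y; rewrite (lhom_join (Max_hom y)) lt_max.
    by move=> [->|->]//; rewrite orbT.
  - move=> y; have [g gy gup] := upper y; exists g => //.
    have := near_lt_continuous fc (@ev_continuous R G g) (c := e) (y := y).
    by rewrite -ltrBlDr => /(_ gy); apply: filterS => z; rewrite ltrBlDr.
exists g => x; rewrite ltr_norml; apply/andP; split.
  by have := glow x; lra.
by have := gup x; lra.
Qed.

(** For every p > 0 the element p (g - h) - 1 is negative at every point, hence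
p (g - h) <= 1. *)
Lemma archimedean_Max_le : archimedean_lgroup G ->
  forall g h, (forall x : M, x g <= x h) -> g <= h.
Proof.
move=> arch g h gh; rewrite -lg_subr_ge0 -lg_lerN2 oppr0 opprB.
apply: (arch _ lunit) => p p0; rewrite -lg_subr_ge0 -lg_lerN2 oppr0 opprB.
apply: (@Max_neg_le0 R) => x; have xh := Max_hom x.
rewrite lhomB// lhomMn// lhomB// lhom_unit// subr_lt0.
by apply: (@le_lt_trans _ _ 0); rewrite ?ltr01// mulrn_wle0// subr_le0.
Qed.

Lemma epsilon_lhom : unital_lhom (epsilon R G).
Proof.
split=> [g h|g h|g h|]; apply: val_inj; apply/funext => x /=.
- rewrite (lhomB (Max_hom x)).
  exact: (esym (lhomB (Ca_ev_lhom R x) (epsilon R G g) (epsilon R G h))).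
- exact: (lhom_meet (Max_hom x)).
- exact: (lhom_join (Max_hom x)).
- exact: (lhom_unit (Max_hom x)).
Qed.

Lemma complete_epsilon_liso :
  metrically_complete R G -> unital_liso (epsilon R G).
Proof.
move=> [arch compl]; have Mle := archimedean_Max_le arch.
split; first exact: epsilon_lhom.
have epsE g x : epsilon R G g x = x g by [].
have einj : injective (epsilon R G).
  move=> g h gh; apply/le_anti/andP.
  by split; apply: Mle => x; rewrite -!epsE gh.
have esurj (f : Ca R M) : exists g, epsilon R G g = f.
  have /choice[u uf] n : exists g, forall x : M, `|x g - f x| < n.+1%:R^-1.
    by apply: epsilon_dense; rewrite invr_gt0.
  have inv_small e : 0 < e -> exists N, forall n, (N <= n)%N ->
      n.+1%:R^-1 < e :> R.
    by move=> e0; have [N _ NP] := near_infty_natSinv_lt (PosNum e0); exists N.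
  have [|l /cvg_unorm ul] := compl u.
    apply/cauchy_ballP => e e0.
    have e3 : 0 < e / 3 by rewrite divr_gt0.
    have [N NP] := inv_small _ e3.
    pose A := [set v : unit_metric R G | exists2 n, (N <= n)%N & v = u n].
    exists (A, A) => [|[_ _] [[m Nm ->] [n Nn ->]]] /=.
      by split; exists N => // n Nn; exists n.
    apply: (@le_lt_trans _ _ (e / 3 + e / 3)); last lra.
    apply: (represented_unorm_le (@Max_hom R G) Mle); first lra.
    move=> x; rewrite (lhomB (Max_hom x)).
    have -> : x (u m) - x (u n) = (x (u m) - f x) + (f x - x (u n)) by lra.
    apply: le_trans (ler_normD _ _) _; rewrite [`|f x - _|]distrC; apply: lerD.
      exact/ltW/(lt_trans (uf m x))/NP.
    exact/ltW/(lt_trans (uf n x))/NP.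
  exists l; apply: val_inj; apply/funext => x /=.
  apply/eqP; rewrite -subr_eq0 -normr_le0; apply/ler_addgt0Pr => e e0.
  have e2 : 0 < e / 2 by rewrite divr_gt0.
  have [N1 N1P] := ul _ e2; have [N2 N2P] := inv_small _ e2.
  pose n := maxn N1 N2.
  have h1 := lhom_unorm (Max_hom x) (l - u n).
  have h2 := N1P n (leq_maxl _ _); have h3 := uf n x.
  have h4 := N2P n (leq_maxr _ _).
  rewrite add0r (_ : x l - f x = x (l - u n) + (x (u n) - f x)).
    apply: le_trans (ler_normD _ _) _; rewrite [e]splitr.
    by apply: lerD; [exact: le_trans h1 (ltW h2)|exact: ltW (lt_trans h3 h4)].
  by rewrite (lhomB (Max_hom x)); lra.
have [e' ee'] := choice esurj.
by exists e' => // g; apply: einj; rewrite ee'.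
Qed.

End EpsilonIso.

Theorem theorem7p9 (R : realType) (G : unitalLGroupType) :
  [<-> metrically_complete R G;
       exists (X : compactASpaceType) (f : G -> Ca R X), unital_liso f;
       unital_liso (epsilon R G)].
Proof.
tfae.
- by move=> /complete_epsilon_liso eiso; exists (Max R G), (epsilon R G).
- by move=> [X [f /Ca_liso_complete]]; exact: complete_epsilon_liso.
- exact: Ca_liso_complete.
Qed.
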